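(* Let $(\mathcal A,\mathcal B,\mathcal C)$ be a recollement of extriangulated categories with functors $i_*:\mathcal A\to\mathcal B$, $i^*,i^!:\mathcal B\to\mathcal A$, $j^*:\mathcal B\to\mathcal C$, $j_!,j_*:\mathcal C\to\mathcal B$, and let $\mathcal X,\mathcal Y,\mathcal Z$ be subcategories of $\mathcal B$. Assume that $i_*i^*(\mathcal X)\subseteq\mathcal X$, $i_*i^*(\mathcal Y)\subseteq\mathcal Y$, $i_*i^*(\mathcal Z)\subseteq\mathcal Z$, $j_*j^*(\mathcal Y)\subseteq\mathcal Y$, $j_*j^*(\mathcal Z)\subseteq\mathcal Z$, and that $i^*$ and $i^!$ are exact. Then the following statements hold. (1) If $(\mathcal X,\mathcal Y,\mathcal Z)$ is a cotorsion triple in $\mathcal B$, then: (a) $(i^*(\mathcal X),i^*(\mathcal Y)=i^!(\mathcal Y),i^!(\mathcal Z))$ is a cotorsion triple in $\mathcal A$ (in particular $i^*(\mathcal Y)=i^!(\mathcal Y)$); (b) $(j^*(\mathcal X),j^*(\mathcal Y),j^*(\mathcal Z))$ is a cotorsion triple in $\mathcal C$; (c) if $(\mathcal X,\mathcal Y,\mathcal Z)$ is hereditary, then so are $(i^*(\mathcal X),i^*(\mathcal Y)=i^!(\mathcal Y),i^!(\mathcal Z))$ and $(j^*(\mathcal X),j^*(\mathcal Y),j^*(\mathcal Z))$. (2) If $(i^*(\mathcal X),i^*(\mathcal Y)=i^!(\mathcal Y),i^!(\mathcal Z))$ and $(j^*(\mathcal X),j^*(\mathcal Y),j^*(\mathcal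 Z))$ are cotorsion triples in $\mathcal A$ and $\mathcal C$ respectively, then $(\mathcal X,\mathcal Y,\mathcal Z)$ is a cotorsion triple in $\mathcal B$ if one of the following conditions is satisfied: (i) $i_*i^*\cong\mathrm{Id}_{\mathcal B}$; (ii) $j_!j^*\cong\mathrm{Id}_{\mathcal B}$ and $j_*j^*\cong\mathrm{Id}_{\mathcal B}$. Moreover, if $(i^*(\mathcal X),i^*(\mathcal Y)=i^!(\mathcal Y),i^!(\mathcal Z))$ or $(j^*(\mathcal X),j^*(\mathcal Y),j^*(\mathcal Z))$ is hereditary, then so is $(\mathcal X,\mathcal Y,\mathcal Z)$.
   Context: Extriangulated categories (Nakaoka–Palu). An extriangulated category is a triple $(\mathcal C,\mathbb E,\mathfrak s)$ with $\mathcal C$ additive and $\mathbb E:\mathcal C^{op}\times\mathcal C\to\mathrm{Ab}$ an additive bifunctor. For $\delta\in\mathbb E(C,A)$, $a:A\to A'$, $c:C'\to C$ write $a_*\delta=\mathbb E(C,a)(\delta)$, $c^*\delta=\mathbb E(c,A)(\delta)$; a morphism from $\delta\in\mathbb E(C,A)$ to $\delta'\in\mathbb E(C',A')$ is a pair $(a:A\to A',c:C\to C')$ with $a_*\delta=c^*\delta'$. Sequences $A\to B\to C$ and $A\to B'\to C$ are equivalent if there is an isomorphism $B\to B'$ compatible with the identities of $A$ and $C$. $\mathfrak s$ assigns to each $\delta\in\mathbb E(C,A)$ an equivalence class $\mathfrak s(\delta)=[A\to B\to C]$ so that every morphism $(a,c)$ of extensions lifts to a morphism $(a,b,c)$ of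 realizing sequences, $\mathfrak s(0)=[A\to A\oplus C\to C]$ and $\mathfrak s(\delta\oplus\delta')=\mathfrak s(\delta)\oplus\mathfrak s(\delta')$. Axioms: (ET3) if $A\xrightarrow{x}B\xrightarrow{y}C$, $A'\xrightarrow{x'}B'\xrightarrow{y'}C'$ realize $\delta,\delta'$ and $bx=x'a$, there is $c$ with $cy=y'b$ and $(a,c):\delta\to\delta'$ a morphism; (ET4) if $A\xrightarrow{f}B\xrightarrow{f'}D$ realizes $\delta$ and $B\xrightarrow{g}C\xrightarrow{g'}F$ realizes $\delta'$, there are an object $E$, $\delta''\in\mathbb E(E,A)$ realized by $A\xrightarrow{gf}C\xrightarrow{h'}E$, and $d:D\to E$, $e:E\to F$ with $df'=h'g$, $eh'=g'$, such that $D\xrightarrow{d}E\xrightarrow{e}F$ realizes $f'_*\delta'$, $d^*\delta''=\delta$, $f_*\delta''=e^*\delta'$; and the duals (ET3)$^{op}$, (ET4)$^{op}$. If $A\xrightarrow{x}B\xrightarrow{y}C$ realizes some $\delta$, it is an $\mathbb E$-triangle ($A\to B\to C\dashrightarrow$), $x$ is an inflation and $y$ a deflation. Standing assumptions. Every extriangulated category satisfies (WIC): for composable $f,g$, if $gf$ is an inflation then $f$ is an inflation, and if $gf$ is a deflation then $g$ is a deflation. Every extriangulated category has enough projectives and enough injectives: $P$ is projective if every morphism $P\to C$ lifts through every deflation $B\to C$; enough projectives means every $M$ is in an $\mathbb E$-triangle $A\to P\to M\dashrightarrow$ with $P$ projective; injectives dually. All subcategories are full, additive and closed under isomorphisms;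 for a functor $F$, $F(\mathcal X)$ denotes the class of objects isomorphic to some $F(X)$, $X\in\mathcal X$. Higher extensions. $\mathbb E^1=\mathbb E$ and $\mathbb E^{k+1}(A,B)=\mathbb E(\Omega^kA,B)\cong\mathbb E(A,\Sigma^kB)$ for $k\ge0$, where $\Omega A$ is given by an $\mathbb E$-triangle $\Omega A\to P\to A\dashrightarrow$ with $P$ projective and $\Sigma B$ by $B\to I\to\Sigma B\dashrightarrow$ with $I$ injective. Cotorsion pairs and triples. A pair $(\mathcal X,\mathcal Y)$ of subcategories of $\mathcal C$ is a cotorsion pair in $\mathcal C$ if (CP1) $\mathbb E(X,Y)=0$ for all $X\in\mathcal X$, $Y\in\mathcal Y$, and (CP2) for every $C\in\mathcal C$ there are $\mathbb E$-triangles $Y^1\to X^1\to C\dashrightarrow$ and $C\to Y_1\to X_1\dashrightarrow$ with $X^1,X_1\in\mathcal X$, $Y^1,Y_1\in\mathcal Y$. It is hereditary if $\mathbb E^i(X,Y)=0$ for all $i\ge2$, $X\in\mathcal X$, $Y\in\mathcal Y$. $(\mathcal X,\mathcal Y,\mathcal Z)$ is a (hereditary) cotorsion triple if $(\mathcal X,\mathcal Y)$ and $(\mathcal Y,\mathcal Z)$ are (hereditary) cotorsion pairs. Exactness (Wang–Wei–Zhang). A morphism is compatible if, whenever it is both an inflation and a deflation, it is an isomorphism. A sequence $A\xrightarrow{f}B\xrightarrow{g}C$ is right exact if there are an $\mathbb E$-triangle $K\xrightarrow{h_2}B\xrightarrow{g}C\dashrightarrow$ and a compatible deflation $h_1:A\to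 K$ with $f=h_2h_1$; it is left exact if there are an $\mathbb E$-triangle $A\xrightarrow{f}B\xrightarrow{h_2}K\dashrightarrow$ and a compatible inflation $h_1:K\to C$ with $g=h_1h_2$. A four-term $\mathbb E$-triangle sequence $A\xrightarrow{f}B\xrightarrow{g}C\xrightarrow{h}D$ is right exact (resp. left exact) if there are $\mathbb E$-triangles $A\xrightarrow{f}B\xrightarrow{g_1}K\dashrightarrow$ and $K\xrightarrow{g_2}C\xrightarrow{h}D\dashrightarrow$ with $g=g_2g_1$ and $g_1$ (resp. $g_2$) compatible. An additive functor $F$ between extriangulated categories is right exact if it preserves compatible morphisms, sends right exact sequences to right exact sequences (so for each $\mathbb E$-triangle $A\xrightarrow{f}B\xrightarrow{g}C\overset{\delta}\dashrightarrow$ there are an $\mathbb E$-triangle $A'\xrightarrow{x}FB\xrightarrow{Fg}FC\dashrightarrow$ and a compatible deflation $y:FA\to A'$ with $Ff=xy$), and the latter $\mathbb E$-triangles are realizations of $\eta(\delta)\in\mathbb E(FC,A')$ for a natural transformation $\eta$; left exact functors are defined dually. $F$ is exact if it preserves compatible morphisms and there is a natural transformation $\eta:\mathbb E(-,-)\Rightarrow\mathbb E(F-,F-)$ with $\mathfrak s(\eta(\delta))=[FA\to FB\to FC]$ whenever $\mathfrak s(\delta)=[A\to B\to C]$. Recollement. A recollement $(\mathcal A,\mathcal B,\mathcal C)$ of extriangulated categories consists of exact functors $i_*:\mathcal A\to\mathcal B$, $j^*:\mathcal B\to\mathcal C$, right exact functors $i^*:\mathcal B\to\mathcal A$, $j_!:\mathcal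 C\to\mathcal B$ and left exact functors $i^!:\mathcal B\to\mathcal A$, $j_*:\mathcal C\to\mathcal B$ such that: (R1) $(i^*,i_*,i^!)$ and $(j_!,j^*,j_* )$ are adjoint triples; (R2) $\operatorname{Im}i_*=\operatorname{Ker}j^*$; (R3) $i_*,j_!,j_*$ are fully faithful; (R4) for each $B\in\mathcal B$ there is a left exact $\mathbb E$-triangle sequence $i_*i^!(B)\to B\to j_*j^*(B)\to i_*(A)$ with $A\in\mathcal A$, the first two maps being adjunction morphisms; (R5) for each $B\in\mathcal B$ there is a right exact $\mathbb E$-triangle sequence $i_*(A')\to j_!j^*(B)\to B\to i_*i^*(B)$ with $A'\in\mathcal A$, the last two maps being adjunction morphisms.
   Formalization: In (1)(a) the equality i^*(Y)=i^!(Y) is claimed only for Y closed under direct summands (it fails otherwise); the ''Moreover'' clause is read in parallel: under (i) if the A-triple is hereditary, under (ii) if the C-triple is (the mixed cases fail). *)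

(* Defs.v *)
From HB Require Import structures.
From mathcomp Require Import all_boot all_order all_algebra.
From mathcomp Require Import boolp.

Set Implicit Arguments.
Unset Strict Implicit.
Unset Printing Implicit Defensive.

Import GRing.Theory.
Local Open Scope ring_scope.

(* Hom-sets and extension groups are [zmodType]s: classically every abelian
   group carries such a structure.  Equality of morphisms is Leibniz. *)

Reserved Notation "g \c f" (at level 40, left associativity).

Record additive_category := AdditiveCategory {
  Ob :> Type;
  Hom : Ob -> Ob -> zmodType;
  idm : forall A, Hom A A;
  comp : forall A B C, Hom B C -> Hom A B -> Hom A C
    where "g \c f" := (comp g f);
  comp_idl : forall A B (f : Hom A B), idm B \c f = f;
  comp_idr : forall A B (f : Hom A B), f \c idm A = f;
  comp_assoc : forall A B C D (h : Hom C D) (g : Hom B C) (f : Hom A B),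
    h \c (g \c f) = (h \c g) \c f;
  compDl : forall A B C (g g' : Hom B C) (f : Hom A B),
    (g + g') \c f = g \c f + g' \c f;
  compDr : forall A B C (g : Hom B C) (f f' : Hom A B),
    g \c (f + f') = g \c f + g \c f';
  zero_ob : Ob;
  zero_obP : idm zero_ob = 0;
  biprod : Ob -> Ob -> Ob;
  inl_ : forall A B, Hom A (biprod A B);
  inr_ : forall A B, Hom B (biprod A B);
  prl_ : forall A B, Hom (biprod A B) A;
  prr_ : forall A B, Hom (biprod A B) B;
  prl_inl : forall A B, prl_ A B \c inl_ A B = idm A;
  prr_inr : forall A B, prr_ A B \c inr_ A B = idm B;
  prl_inr : forall A B, prl_ A B \c inr_ A B = 0;
  prr_inl : forall A B, prr_ A B \c inl_ A B = 0;
  biprod_sum : forall A B,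
    inl_ A B \c prl_ A B + inr_ A B \c prr_ A B = idm (biprod A B)
}.

Notation "g \c f" := (comp g f).

Definition iso (K : additive_category) (A B : K) (f : Hom A B) : Prop :=
  exists g : Hom B A, g \c f = idm A /\ f \c g = idm B.

Definition isomorphic (K : additive_category) (A B : K) : Prop :=
  exists f : Hom A B, iso f.

Definition is_zero (K : additive_category) (A : K) : Prop := idm A = 0.

Definition hom_sum (K : additive_category) (A A' B B' : K)
    (f : Hom A B) (f' : Hom A' B') : Hom (biprod A A') (biprod B B') :=
  inl_ B B' \c f \c prl_ A A' + inr_ B B' \c f' \c prr_ A A'.

(* Additive bifunctors K^op x K -> Ab; [ext_group E C A] is E(C, A),
   [push_ E a d] is a_* d and [pull_ E c d] is c^* d. *)
Record ext_bifunctor (K : additive_category) := ExtBifunctor {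
  ext_group : K -> K -> zmodType;
  push_ : forall (C A A' : K), Hom A A' ->
    {additive ext_group C A -> ext_group C A'};
  pull_ : forall (C C' A : K), Hom C' C ->
    {additive ext_group C A -> ext_group C' A};
  push_id : forall C A (d : ext_group C A), push_ C (idm A) d = d;
  push_comp : forall C A A' A'' (a' : Hom A' A'') (a : Hom A A')
    (d : ext_group C A), push_ C (a' \c a) d = push_ C a' (push_ C a d);
  pushD : forall C A A' (a a' : Hom A A') (d : ext_group C A),
    push_ C (a + a') d = push_ C a d + push_ C a' d;
  pull_id : forall C A (d : ext_group C A), pull_ A (idm C) d = d;
  pull_comp : forall C C' C'' A (c : Hom C' C) (c' : Hom C'' C')
    (d : ext_group C A), pull_ A (c \c c') d = pull_ A c' (pull_ A c d);
  pullD : forall C C' A (c c' : Hom C' C) (d : ext_group C A),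
    pull_ A (c + c') d = pull_ A c d + pull_ A c' d;
  push_pull : forall C C' A A' (a : Hom A A') (c : Hom C' C)
    (d : ext_group C A),
    push_ C' a (pull_ A c d) = pull_ A' c (push_ C a d)
}.

Arguments push_ {K} _ {C A A'} _.
Arguments pull_ {K} _ {C C' A} _.

(* A correspondence s sending each d in E(C, A) to an equivalence class of
   sequences is given as the relation "x, y is a member of s(d)". *)
Definition realization (K : additive_category) (E : ext_bifunctor K) :=
  forall (A C : K), ext_group E C A ->
  forall B : K, Hom A B -> Hom B C -> Prop.

Definition seq_equiv (K : additive_category) (A C B B' : K)
    (x : Hom A B) (y : Hom B C) (x' : Hom A B') (y' : Hom B' C) : Prop :=
  exists b : Hom B B', [/\ iso b, b \c x = x' & y' \c b = y].

Section Conditions.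
Variables (K : additive_category) (E : ext_bifunctor K) (s : realization E).
Arguments s {A C} _ {B} _ _.

Definition ext_morphism (A C A' C' : K)
    (d : ext_group E C A) (d' : ext_group E C' A')
    (a : Hom A A') (c : Hom C C') : Prop := push_ E a d = pull_ E c d'.

Definition ext_sum (A C A' C' : K)
    (d : ext_group E C A) (d' : ext_group E C' A') :
    ext_group E (biprod C C') (biprod A A') :=
  push_ E (inl_ A A') (pull_ E (prl_ C C') d)
  + push_ E (inr_ A A') (pull_ E (prr_ C C') d').

Definition realization_class : Prop :=
  forall (A C : K) (d : ext_group E C A),
    (exists B (x : Hom A B) (y : Hom B C), s d x y)
    /\ forall B (x : Hom A B) (y : Hom B C), s d x y ->
       forall B' (x' : Hom A B') (y' : Hom B' C),
         s d x' y' <-> seq_equiv x y x' y'.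

Definition realization_lift : Prop :=
  forall (A B C A' B' C' : K)
    (d : ext_group E C A) (d' : ext_group E C' A')
    (x : Hom A B) (y : Hom B C) (x' : Hom A' B') (y' : Hom B' C'),
    s d x y -> s d' x' y' ->
  forall (a : Hom A A') (c : Hom C C'), ext_morphism d d' a c ->
  exists b : Hom B B', b \c x = x' \c a /\ y' \c b = c \c y.

Definition realization_zero : Prop :=
  forall A C : K, s (0 : ext_group E C A) (inl_ A C) (prr_ A C).

Definition realization_sum : Prop :=
  forall (A B C A' B' C' : K)
    (d : ext_group E C A) (d' : ext_group E C' A')
    (x : Hom A B) (y : Hom B C) (x' : Hom A' B') (y' : Hom B' C'),
    s d x y -> s d' x' y' ->
    s (ext_sum d d') (hom_sum x x') (hom_sum y y').

Definition ET3 : Prop :=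
  forall (A B C A' B' C' : K)
    (d : ext_group E C A) (d' : ext_group E C' A')
    (x : Hom A B) (y : Hom B C) (x' : Hom A' B') (y' : Hom B' C'),
    s d x y -> s d' x' y' ->
  forall (a : Hom A A') (b : Hom B B'), b \c x = x' \c a ->
  exists c : Hom C C', c \c y = y' \c b /\ ext_morphism d d' a c.

Definition ET3op : Prop :=
  forall (A B C A' B' C' : K)
    (d : ext_group E C A) (d' : ext_group E C' A')
    (x : Hom A B) (y : Hom B C) (x' : Hom A' B') (y' : Hom B' C'),
    s d x y -> s d' x' y' ->
  forall (b : Hom B B') (c : Hom C C'), c \c y = y' \c b ->
  exists a : Hom A A', b \c x = x' \c a /\ ext_morphism d d' a c.

Definition ET4 : Prop :=
  forall (A B C D F : K) (d1 : ext_group E D A) (d2 : ext_group E F B)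
    (f : Hom A B) (f' : Hom B D) (g : Hom B C) (g' : Hom C F),
    s d1 f f' -> s d2 g g' ->
  exists (X : K) (d3 : ext_group E X A) (h' : Hom C X)
         (d : Hom D X) (e : Hom X F),
    s d3 (g \c f) h'
    /\ d \c f' = h' \c g
    /\ e \c h' = g'
    /\ s (push_ E f' d2) d e
    /\ pull_ E d d3 = d1
    /\ push_ E f d3 = pull_ E e d2.

Definition ET4op : Prop :=
  forall (A B C D F : K) (d1 : ext_group E B D) (d2 : ext_group E C F)
    (f' : Hom D A) (f : Hom A B) (g' : Hom F B) (g : Hom B C),
    s d1 f' f -> s d2 g' g ->
  exists (X : K) (d3 : ext_group E C X) (h' : Hom X A)
         (d : Hom D X) (e : Hom X F),
    s d3 h' (g \c f)
    /\ h' \c d = f'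
    /\ f \c h' = g' \c e
    /\ s (pull_ E g' d1) d e
    /\ push_ E e d3 = d2
    /\ push_ E d d1 = pull_ E g d3.

End Conditions.

Record extriangulated_category := ExtriangulatedCategory {
  et_cat :> additive_category;
  et_ext : ext_bifunctor et_cat;
  realizes : realization et_ext;
  et_class : realization_class realizes;
  et_lift : realization_lift realizes;
  et_zero : realization_zero realizes;
  et_sum : realization_sum realizes;
  et_ET3 : ET3 realizes;
  et_ET3op : ET3op realizes;
  et_ET4 : ET4 realizes;
  et_ET4op : ET4op realizes
}.

Arguments realizes {_ A C} _ {B} _ _.

Definition ext (K : extriangulated_category) (C A : K) : zmodType :=
  ext_group (et_ext K) C A.
Definition push (K : extriangulated_category) (C A A' : K) (a : Hom A A') :
  {additive ext C A -> ext C A'} := push_ (et_ext K) a.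
Definition pull (K : extriangulated_category) (C C' A : K) (c : Hom C' C) :
  {additive ext C A -> ext C' A} := pull_ (et_ext K) c.

Arguments push {K C A A'} _.
Arguments pull {K C C' A} _.

Section Extriangulated.
Variable K : extriangulated_category.
Implicit Types A B C D M P I : K.

Definition etriangle A B C (x : Hom A B) (y : Hom B C) : Prop :=
  exists d : ext C A, realizes d x y.

Definition inflation A B (x : Hom A B) : Prop :=
  exists C (y : Hom B C), etriangle x y.

Definition deflation B C (y : Hom B C) : Prop :=
  exists A (x : Hom A B), etriangle x y.

Definition WIC : Prop :=
  (forall A B C (f : Hom A B) (g : Hom B C),
     inflation (g \c f) -> inflation f)
  /\ (forall A B C (f : Hom A B) (g : Hom B C),
     deflation (g \c f) -> deflation g).

Definition projective P : Prop :=
  forall B C (g : Hom B C), deflation g ->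
  forall f : Hom P C, exists f' : Hom P B, g \c f' = f.

Definition injective_ob I : Prop :=
  forall A B (g : Hom A B), inflation g ->
  forall f : Hom A I, exists f' : Hom B I, f' \c g = f.

(* [is_syzygy M A] : A is a possible value of Omega M. *)
Definition is_syzygy M A : Prop :=
  exists P (x : Hom A P) (y : Hom P M), projective P /\ etriangle x y.

Definition is_cosyzygy M A : Prop :=
  exists I (x : Hom M I) (y : Hom I A), injective_ob I /\ etriangle x y.

Definition enough_projectives : Prop := forall M, exists A, is_syzygy M A.
Definition enough_injectives : Prop := forall M, exists A, is_cosyzygy M A.

Definition compatible A B (f : Hom A B) : Prop :=
  inflation f -> deflation f -> iso f.

Definition right_exact3 A B C (f : Hom A B) (g : Hom B C) : Prop :=
  exists D (h2 : Hom D B) (h1 : Hom A D),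
    [/\ etriangle h2 g, deflation h1, compatible h1 & f = h2 \c h1].

Definition left_exact3 A B C (f : Hom A B) (g : Hom B C) : Prop :=
  exists D (h2 : Hom B D) (h1 : Hom D C),
    [/\ etriangle f h2, inflation h1, compatible h1 & g = h1 \c h2].

Definition right_exact4 A B C D
    (f : Hom A B) (g : Hom B C) (h : Hom C D) : Prop :=
  exists M (g1 : Hom B M) (g2 : Hom M C),
    [/\ etriangle f g1, etriangle g2 h, g = g2 \c g1 & compatible g1].

Definition left_exact4 A B C D
    (f : Hom A B) (g : Hom B C) (h : Hom C D) : Prop :=
  exists M (g1 : Hom B M) (g2 : Hom M C),
    [/\ etriangle f g1, etriangle g2 h, g = g2 \c g1 & compatible g2].

End Extriangulated.

(* The standing assumptions on extriangulated categories. *)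
Record ET_category := ETCategory {
  et_base :> extriangulated_category;
  et_WIC : WIC et_base;
  et_enough_projectives : enough_projectives et_base;
  et_enough_injectives : enough_injectives et_base
}.

(* A chosen syzygy; it is unique up to projective summands. *)
Definition Omega (K : ET_category) (M : K) : K :=
  projT1 (cid (et_enough_projectives M)).

(* E^n(A, B) for n >= 1 (the value at n = 0 is irrelevant). *)
Definition higher_ext (K : ET_category) (n : nat) (A B : K) : zmodType :=
  ext (iter n.-1 (@Omega K) A) B.

Definition trivial_group (V : zmodType) : Prop := forall v : V, v = 0.

Record additive_functor (K L : additive_category) := AdditiveFunctor {
  fob :> K -> L;
  fmap : forall A B : K, {additive Hom A B -> Hom (fob A) (fob B)};
  fmap_id : forall A : K, fmap A A (idm A) = idm (fob A);
  fmap_comp : forall (A B C : K) (g : Hom B C) (f : Hom A B),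
    fmap A C (g \c f) = fmap B C g \c fmap A B f
}.

Notation "F <$> f" := (fmap F _ _ f)
  (at level 35, f at level 35, right associativity).

Lemma id_fmap_id (K : additive_category) (A : K) :
  (idfun : {additive Hom A A -> Hom A A}) (idm A) = idm A.
Proof. by []. Qed.

Lemma id_fmap_comp (K : additive_category) (A B C : K)
    (g : Hom B C) (f : Hom A B) :
  (idfun : {additive Hom A C -> Hom A C}) (g \c f) =
  (idfun : {additive Hom B C -> Hom B C}) g \c
  (idfun : {additive Hom A B -> Hom A B}) f.
Proof. by []. Qed.

Definition id_functor (K : additive_category) : additive_functor K K :=
  @AdditiveFunctor K K id
    (fun A B => idfun : {additive Hom A B -> Hom A B})
    (@id_fmap_id K) (@id_fmap_comp K).

Section Composite.
Variables (K L M : additive_category).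
Variables (G : additive_functor L M) (F : additive_functor K L).

Definition comp_fmap (A B : K) :
  {additive Hom A B -> Hom (G (F A)) (G (F B))} :=
  fmap G (F A) (F B) \o fmap F A B.

Lemma comp_fmap_id (A : K) : comp_fmap A A (idm A) = idm (G (F A)).
Proof. by rewrite /comp_fmap /= !fmap_id. Qed.

Lemma comp_fmap_comp (A B C : K) (g : Hom B C) (f : Hom A B) :
  comp_fmap A C (g \c f) = comp_fmap B C g \c comp_fmap A B f.
Proof. by rewrite /comp_fmap /= !fmap_comp. Qed.

Definition comp_functor : additive_functor K M :=
  @AdditiveFunctor K M (fun A => G (F A)) comp_fmap
    comp_fmap_id comp_fmap_comp.

End Composite.

Notation "G \F F" := (comp_functor G F) (at level 40, left associativity).

Definition nat_isomorphic (K L : additive_category)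
    (F G : additive_functor K L) : Prop :=
  exists t : forall A : K, Hom (F A) (G A),
    (forall A, iso (t A))
    /\ forall (A B : K) (f : Hom A B), t B \c (F <$> f) = (G <$> f) \c t A.

Record adjunction (K L : additive_category)
    (F : additive_functor K L) (G : additive_functor L K) := Adjunction {
  adj_unit : forall A : K, Hom A (G (F A));
  adj_counit : forall B : L, Hom (F (G B)) B;
  adj_unit_nat : forall (A A' : K) (f : Hom A A'),
    adj_unit A' \c f = (G <$> F <$> f) \c adj_unit A;
  adj_counit_nat : forall (B B' : L) (f : Hom B B'),
    adj_counit B' \c (F <$> G <$> f) = f \c adj_counit B;
  adj_triangle_l : forall A : K,
    adj_counit (F A) \c (F <$> adj_unit A) = idm (F A);
  adj_triangle_r : forall B : L,
    (G <$> adj_counit B) \c adj_unit (G B) = idm (G B)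
}.

Definition fully_faithful (K L : additive_category)
    (F : additive_functor K L) : Prop :=
  forall A B : K, bijective (fmap F A B).

(* The class F(X) of objects isomorphic to F(A) for some A in X. *)
Definition image_class (K L : additive_category)
    (F : additive_functor K L) (X : K -> Prop) : L -> Prop :=
  fun B => exists A : K, X A /\ isomorphic (F A) B.

Definition preserves_compatible (K L : extriangulated_category)
    (F : additive_functor K L) : Prop :=
  forall (A B : K) (f : Hom A B), compatible f -> compatible (F <$> f).

(* Natural transformations between the Ab-valued functors E_K and E_L(F, F). *)
Definition exact (K L : extriangulated_category)
    (F : additive_functor K L) : Prop :=
  preserves_compatible F
  /\ exists eta : forall C A : K, {additive ext C A -> ext (F C) (F A)},
    [/\ forall (C A A' : K) (a : Hom A A') (d : ext C A),
          eta C A' (push a d) = push (F <$> a) (eta C A d),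
        forall (C C' A : K) (c : Hom C' C) (d : ext C A),
          eta C' A (pull c d) = pull (F <$> c) (eta C A d)
      & forall (A B C : K) (d : ext C A) (x : Hom A B) (y : Hom B C),
          realizes d x y -> realizes (eta C A d) (F <$> x) (F <$> y)].

(* In the E-triangle A' -> FB -> FC attached to d in E(C, A), the object A'
   and the compatible deflation FA -> A' depend on d; they are denoted T d and
   p d.  Naturality of eta is therefore expressed along morphisms (a, c) of
   extensions: FA -> FA' descends to T d -> T d', and the descended morphism
   together with Fc is a morphism eta d -> eta d'. *)
Definition right_exact (K L : extriangulated_category)
    (F : additive_functor K L) : Prop :=
  [/\ preserves_compatible F,
      forall (A B C : K) (f : Hom A B) (g : Hom B C),
        right_exact3 f g -> right_exact3 (F <$> f) (F <$> g)
    & exists (T : forall A C : K, ext C A -> L)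
             (p : forall (A C : K) (d : ext C A), Hom (F A) (T A C d))
             (eta : forall (A C : K) (d : ext C A), ext (F C) (T A C d)),
      [/\ forall (A C : K) (d : ext C A),
            deflation (p A C d) /\ compatible (p A C d),
          forall (A B C : K) (d : ext C A) (f : Hom A B) (g : Hom B C),
            realizes d f g ->
            exists x : Hom (T A C d) (F B),
              F <$> f = x \c p A C d /\ realizes (eta A C d) x (F <$> g)
        & forall (A C A' C' : K) (d : ext C A) (d' : ext C' A')
            (a : Hom A A') (c : Hom C C'),
            push a d = pull c d' ->
            exists a' : Hom (T A C d) (T A' C' d'),
              a' \c p A C d = p A' C' d' \c (F <$> a)
              /\ push a' (eta A C d)
                 = pull (F <$> c) (eta A' C' d')]].

Definition left_exact (K L : extriangulated_category)
    (F : additive_functor K L) : Prop :=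
  [/\ preserves_compatible F,
      forall (A B C : K) (f : Hom A B) (g : Hom B C),
        left_exact3 f g -> left_exact3 (F <$> f) (F <$> g)
    & exists (T : forall A C : K, ext C A -> L)
             (m : forall (A C : K) (d : ext C A), Hom (T A C d) (F C))
             (eta : forall (A C : K) (d : ext C A), ext (T A C d) (F A)),
      [/\ forall (A C : K) (d : ext C A),
            inflation (m A C d) /\ compatible (m A C d),
          forall (A B C : K) (d : ext C A) (f : Hom A B) (g : Hom B C),
            realizes d f g ->
            exists y : Hom (F B) (T A C d),
              F <$> g = m A C d \c y /\ realizes (eta A C d) (F <$> f) y
        & forall (A C A' C' : K) (d : ext C A) (d' : ext C' A')
            (a : Hom A A') (c : Hom C C'),
            push a d = pull c d' ->
            exists c' : Hom (T A C d) (T A' C' d'),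
              m A' C' d' \c c' = (F <$> c) \c m A C d
              /\ push (F <$> a) (eta A C d)
                 = pull c' (eta A' C' d')]].

(* Subscripts and superscripts are spelled out:
   il_star = i_*, iu_star = i^*, iu_shriek = i^!,
   ju_star = j^*, jl_star = j_*, jl_shriek = j_!. *)
Record recollement (A B C : extriangulated_category) := Recollement {
  il_star : additive_functor A B;
  iu_star : additive_functor B A;
  iu_shriek : additive_functor B A;
  ju_star : additive_functor B C;
  jl_shriek : additive_functor C B;
  jl_star : additive_functor C B;
  il_star_exact : exact il_star;
  ju_star_exact : exact ju_star;
  iu_star_right_exact : right_exact iu_star;
  jl_shriek_right_exact : right_exact jl_shriek;
  iu_shriek_left_exact : left_exact iu_shriek;
  jl_star_left_exact : left_exact jl_star;
  adj_iu_il : adjunction iu_star il_star;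
  adj_il_iu : adjunction il_star iu_shriek;
  adj_jl_ju : adjunction jl_shriek ju_star;
  adj_ju_jl : adjunction ju_star jl_star;
  im_il_ker_ju : forall X : B,
    (exists Y : A, isomorphic (il_star Y) X) <-> is_zero (ju_star X);
  il_star_ff : fully_faithful il_star;
  jl_shriek_ff : fully_faithful jl_shriek;
  jl_star_ff : fully_faithful jl_star;
  left_exact_seq : forall X : B,
    exists (Y : A) (h : Hom (jl_star (ju_star X)) (il_star Y)),
      left_exact4 (adj_counit adj_il_iu X) (adj_unit adj_ju_jl X) h;
  right_exact_seq : forall X : B,
    exists (Y : A) (h : Hom (il_star Y) (jl_shriek (ju_star X))),
      right_exact4 h (adj_counit adj_jl_ju X) (adj_unit adj_iu_il X)
}.

Definition subclass (T : Type) (X Y : T -> Prop) : Prop :=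
  forall A, X A -> Y A.

Definition same_class (T : Type) (X Y : T -> Prop) : Prop :=
  forall A, X A <-> Y A.

(* Full subcategories are given by their classes of objects. *)
Definition additive_subcategory (K : additive_category) (X : K -> Prop) : Prop :=
  [/\ X (zero_ob K),
      forall A B : K, X A -> X B -> X (biprod A B)
    & forall A B : K, isomorphic A B -> X A -> X B].

Definition summand_closed (K : additive_category) (X : K -> Prop) : Prop :=
  forall A M N : K, X A -> isomorphic A (biprod M N) -> X M.

Definition cotorsion_pair (K : extriangulated_category)
    (X Y : K -> Prop) : Prop :=
  [/\ additive_subcategory X, additive_subcategory Y,
      forall A B : K, X A -> Y B -> trivial_group (ext A B)
    & forall C : K,
        (exists (B A : K) (x : Hom B A) (y : Hom A C),
           [/\ Y B, X A & etriangle x y])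
        /\ (exists (B A : K) (x : Hom C B) (y : Hom B A),
           [/\ Y B, X A & etriangle x y])].

Definition hereditary_cotorsion_pair (K : ET_category)
    (X Y : K -> Prop) : Prop :=
  cotorsion_pair X Y
  /\ forall n : nat, (2 <= n)%N ->
     forall A B : K, X A -> Y B -> trivial_group (higher_ext n A B).

Definition cotorsion_triple (K : extriangulated_category)
    (X Y Z : K -> Prop) : Prop :=
  cotorsion_pair X Y /\ cotorsion_pair Y Z.

Definition hereditary_cotorsion_triple (K : ET_category)
    (X Y Z : K -> Prop) : Prop :=
  hereditary_cotorsion_pair X Y /\ hereditary_cotorsion_pair Y Z.

(* Main.v *)
From mathcomp Require Import all_boot all_order all_algebra.
From mathcomp Require Import boolp.
Require Import Defs.

Set Implicit Arguments.
Unset Strict Implicit.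
Unset Printing Implicit Defensive.

Import GRing.Theory.
Local Open Scope ring_scope.

(** Two observations carry the proof.

    First, vanishing of extensions can be moved across an adjunction
    F -| G without any natural isomorphism between E(F M, N) and E(M, G N).
    If G preserves E-triangles and E(M, G N) = 0, then an extension of F M by
    N becomes, after applying G, one along which the unit of M lifts, and the
    transpose of the lift splits the original extension
    ([orthogonal_left_adjoint]); dually E(F M, N) = 0 gives E(M, G N) = 0 when
    F preserves E-triangles ([orthogonal_right_adjoint]).  When both functors
    preserve E-triangles, F also preserves projectives, so it carries the
    syzygies of M to syzygies of F M.  Syzygies are unique up to retracts
    modulo morphisms factoring through projectives, a relation that is itself
    inherited by syzygies ([syzygy_stable_retract]) and that preserves the
    vanishing of E(-, N).  Hence both transfers hold in every degree
    ([perpendicular_left_adjoint], [perpendicular_right_adjoint]), and the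
    hereditary claims are proved together with the plain ones.

    Secondly, the exactness of i^! makes j_* preserve E-triangles
    ([jl_preserves]): the failure of j_* to be exact is measured by an object
    killed by both i^! and j^*, and such an object is zero.  So the transfers
    apply to the three adjunctions i^* -| i_*, i_* -| i^! and j^* -| j_*.

    The classes are matched as follows.  E(i^* M, i^* N) reduces to
    E(M, i_* i^* N), E(i^* M, i^! N) to E(i_* i^* M, N), and E(j^* M, j^* N)
    to E(M, j_* j^* N); the closure hypotheses say that the objects so
    obtained stay in the given classes.  Approximations of an object of A or C
    are the images of approximations of its image in B under i_* or j_*, as
    i^* i_* and j^* j_* are isomorphic to the identity.  In the converse
    direction, i_* i^* or j_* j^* is the identity up to isomorphism and the
    same transfers and images are used from A or C to B. *)

(** * Additive categories *)

Section Additive.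
Variable K : additive_category.
Implicit Types A B C M N : K.

Lemma comp0l A B C (f : Hom A B) : (0 : Hom B C) \c f = 0.
Proof. by apply: (addIr ((0 : Hom B C) \c f)); rewrite -compDl !add0r. Qed.

Lemma comp0r A B C (g : Hom B C) : g \c (0 : Hom A B) = 0.
Proof. by apply: (addIr (g \c (0 : Hom A B))); rewrite -compDr !add0r. Qed.

Lemma compNl A B C (g : Hom B C) (f : Hom A B) : (- g) \c f = - (g \c f).
Proof. by apply: (addIr (g \c f)); rewrite -compDl !addNr comp0l. Qed.

Lemma compNr A B C (g : Hom B C) (f : Hom A B) : g \c (- f) = - (g \c f).
Proof. by apply: (addIr (g \c f)); rewrite -compDr !addNr comp0r. Qed.

Lemma compBl A B C (g g' : Hom B C) (f : Hom A B) :
  (g - g') \c f = g \c f - g' \c f.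
Proof. by rewrite compDl compNl. Qed.

Lemma compBr A B C (g : Hom B C) (f f' : Hom A B) :
  g \c (f - f') = g \c f - g \c f'.
Proof. by rewrite compDr compNr. Qed.

Lemma from_zero A B (f : Hom A B) : is_zero A -> f = 0.
Proof. by move=> zA; rewrite -[f]comp_idr zA comp0r. Qed.

Lemma to_zero A B (f : Hom A B) : is_zero B -> f = 0.
Proof. by move=> zB; rewrite -[f]comp_idl zB comp0l. Qed.

Lemma is_zero_iso A B : isomorphic A B -> is_zero A -> is_zero B.
Proof.
by move=> [f [g [_ fg]]] zA; rewrite /is_zero -fg (to_zero g zA) comp0r.
Qed.

Lemma iso_of_inverses A B (f : Hom A B) (g h : Hom B A) :
  g \c f = idm A -> f \c h = idm B -> iso f.
Proof.
move=> gf fh; exists g; split=> //.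
by rewrite -[g]comp_idr -fh (comp_assoc g) gf comp_idl.
Qed.

Lemma isomorphic_refl A : isomorphic A A.
Proof. by exists (idm A), (idm A); rewrite comp_idl. Qed.

Lemma isomorphic_sym A B : isomorphic A B -> isomorphic B A.
Proof. by move=> [f [g [gf fg]]]; exists g, f. Qed.

Lemma isomorphic_trans A B C :
  isomorphic A B -> isomorphic B C -> isomorphic A C.
Proof.
move=> [f [f' [f'f ff']]] [g [g' [g'g gg']]].
exists (g \c f), (f' \c g'); split.
  by rewrite comp_assoc -(comp_assoc f') g'g comp_idr.
by rewrite comp_assoc -(comp_assoc g) ff' comp_idr.
Qed.

Lemma zero_isomorphic A B : is_zero A -> is_zero B -> isomorphic A B.
Proof. by move=> zA zB; exists 0, 0; rewrite !comp0l zA zB. Qed.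

Lemma biprod_unique A B P (i : Hom A P) (j : Hom B P)
    (p : Hom P A) (q : Hom P B) :
  p \c i = idm A -> q \c j = idm B -> p \c j = 0 -> q \c i = 0 ->
  i \c p + j \c q = idm P -> isomorphic P (biprod A B).
Proof.
move=> pi qj pj qi ipjq.
exists (inl_ A B \c p + inr_ A B \c q), (i \c prl_ A B + j \c prr_ A B).
split.
  rewrite !compDl !compDr !comp_assoc.
  rewrite -!(comp_assoc _ (prl_ _ _)) -!(comp_assoc _ (prr_ _ _)).
  rewrite prl_inl prl_inr prr_inl prr_inr !comp_idr !comp0r !comp0l.
  by rewrite addr0 add0r.
rewrite !compDl !compDr !comp_assoc.
rewrite -!(comp_assoc _ p) -!(comp_assoc _ q) pi qj pj qi !comp_idr.
by rewrite !comp0r !comp0l addr0 add0r biprod_sum.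
Qed.

Lemma additive_subcategory_iso (X : K -> Prop) A B :
  additive_subcategory X -> isomorphic A B -> X A -> X B.
Proof. by case=> _ _ isoX; apply: isoX. Qed.

End Additive.

(** * Functors and adjunctions *)

Section Functors.
Variables K L : additive_category.
Implicit Types (F : additive_functor K L) (G : additive_functor L K).

Lemma fmap_iso F (A B : K) (f : Hom A B) : iso f -> iso (F <$> f).
Proof.
by move=> [g [gf fg]]; exists (F <$> g); rewrite -!fmap_comp gf fg !fmap_id.
Qed.

Lemma fmap_isomorphic F (A B : K) :
  isomorphic A B -> isomorphic (F A) (F B).
Proof. by move=> [f isof]; exists (F <$> f); apply: fmap_iso. Qed.

Lemma fmap_zero F (A : K) : is_zero A -> is_zero (F A).
Proof. by move=> zA; rewrite /is_zero -fmap_id zA raddf0. Qed.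

Lemma image_class_in F (X : K -> Prop) A : X A -> image_class F X (F A).
Proof. by move=> XA; exists A; split=> //; apply: isomorphic_refl. Qed.

Lemma image_class_sub F (X : K -> Prop) (X' : L -> Prop) :
  additive_subcategory X' -> (forall M, X M -> X' (F M)) ->
  subclass (image_class F X) X'.
Proof.
by move=> [_ _ isoX'] FX N [M [XM isoMN]]; apply: isoX' isoMN (FX M XM).
Qed.

Lemma image_class_additive F (X : K -> Prop) :
  additive_subcategory X -> additive_subcategory (image_class F X).
Proof.
move=> [X0 Xsum Xiso]; split.
- exists (zero_ob K); split=> //; apply: zero_isomorphic (zero_obP L).
  by apply: fmap_zero; apply: zero_obP.
- move=> A' B' [A [XA [u [u' [u'u uu']]]]] [B [XB [v [v' [v'v vv']]]]].
  exists (biprod A B); split; first exact: Xsum.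
  have compA4 (M0 M1 M2 M3 M4 : L) (a : Hom M3 M4) (b : Hom M2 M3)
      (c : Hom M1 M2) (d : Hom M0 M1) :
      (a \c b) \c (c \c d) = a \c (b \c c) \c d.
    by rewrite !comp_assoc.
  apply: (@biprod_unique _ _ _ _ ((F <$> inl_ A B) \c u')
    ((F <$> inr_ A B) \c v') (u \c (F <$> prl_ A B)) (v \c (F <$> prr_ A B)));
    rewrite !compA4 -?fmap_comp.
  + by rewrite prl_inl fmap_id comp_idr.
  + by rewrite prr_inr fmap_id comp_idr.
  + by rewrite prl_inr raddf0 comp0r comp0l.
  + by rewrite prr_inl raddf0 comp0r comp0l.
  + by rewrite u'u v'v !comp_idr -!fmap_comp -raddfD biprod_sum fmap_id.
- move=> A' B' isoAB [A [XA isoA]]; exists A; split=> //.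
  exact: isomorphic_trans isoA isoAB.
Qed.

(** The object [G N] is itself in the image of [G], so its unit is [G u] for
    some [u]; the triangle identities make [u] inverse to the counit. *)
Lemma counit_iso F G (adj : adjunction F G) :
  fully_faithful G -> forall N, iso (adj_counit adj N).
Proof.
move=> ffG N; have [g gK Kg] := ffG N (F (G N)).
have [h hK _] := ffG N N.
set u := g (adj_unit adj (G N)).
have Gu : G <$> u = adj_unit adj (G N) by rewrite Kg.
exists u; split.
  by rewrite -adj_counit_nat Gu adj_triangle_l.
by apply: (can_inj hK); rewrite fmap_comp Gu adj_triangle_r fmap_id.
Qed.

Lemma unit_iso F G (adj : adjunction F G) :
  fully_faithful F -> forall M, iso (adj_unit adj M).
Proof.
move=> ffF M; have [g gK Kg] := ffF (G (F M)) M.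
have [h hK _] := ffF M M.
set u := g (adj_counit adj (F M)).
have Fu : F <$> u = adj_counit adj (F M) by rewrite Kg.
exists u; split; last by rewrite adj_unit_nat Fu adj_triangle_r.
by apply: (can_inj hK); rewrite fmap_comp Fu adj_triangle_l fmap_id.
Qed.

End Functors.

Section Composites.
Variables K L : additive_category.
Variables (F : additive_functor K L) (G : additive_functor L K).

Lemma image_class_comp_sub (X : K -> Prop) :
  subclass (image_class (G \F F) X) X ->
  forall N, image_class F X N -> X (G N).
Proof.
move=> GFX N [M [XM isoM]]; apply: GFX.
by exists M; split=> //; apply: (fmap_isomorphic G).
Qed.

Lemma nat_isomorphic_id (M : K) :
  nat_isomorphic (G \F F) (id_functor K) -> isomorphic (G (F M)) M.
Proof. by move=> [t [isot _]]; exists (t M); apply: isot. Qed.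

Lemma subclass_image_class_comp (X : K -> Prop) :
  (forall M, isomorphic (G (F M)) M) ->
  subclass X (image_class G (image_class F X)).
Proof.
by move=> GF M XM; exists (F M); split; [exact: image_class_in | exact: GF].
Qed.

End Composites.

(** * Elementary properties of E-triangles *)

Section Triangles.
Variable K : extriangulated_category.
Implicit Types A B C M N P S U V W : K.

Lemma push_idE C A (d : ext C A) : push (idm A) d = d.
Proof. exact: push_id. Qed.

Lemma push_compE C A A' A'' (a' : Hom A' A'') (a : Hom A A') (d : ext C A) :
  push (a' \c a) d = push a' (push a d).
Proof. exact: push_comp. Qed.

Lemma pull_idE C A (d : ext C A) : pull (idm C) d = d.
Proof. exact: pull_id. Qed.

Lemma pull_compE C C' C'' A (c : Hom C' C) (c' : Hom C'' C') (d : ext C A) :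
  pull (c \c c') d = pull c' (pull c d).
Proof. exact: pull_comp. Qed.

Lemma push_pullE C C' A A' (a : Hom A A') (c : Hom C' C) (d : ext C A) :
  push a (pull c d) = pull c (push a d).
Proof. exact: push_pull. Qed.

Lemma push0l C A A' (d : ext C A) : push (0 : Hom A A') d = 0.
Proof.
by apply: (addIr (push 0 d)); rewrite -[LHS]pushD !add0r.
Qed.

Lemma pull0l C C' A (d : ext C A) : pull (0 : Hom C' C) d = 0.
Proof.
by apply: (addIr (pull 0 d)); rewrite -[LHS]pullD !add0r.
Qed.

Lemma pushB C A A' (a a' : Hom A A') (d : ext C A) :
  push (a - a') d = push a d - push a' d.
Proof.
by apply: (addIr (push a' d)); rewrite subrK -[LHS]pushD subrK.
Qed.

Lemma pullB C C' A (c c' : Hom C' C) (d : ext C A) :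
  pull (c - c') d = pull c d - pull c' d.
Proof.
by apply: (addIr (pull c' d)); rewrite subrK -[LHS]pullD subrK.
Qed.

Lemma ext_from_zero C A (d : ext C A) : is_zero C -> d = 0.
Proof. by move=> zC; rewrite -[d]pull_idE zC pull0l. Qed.

Lemma ext_to_zero C A (d : ext C A) : is_zero A -> d = 0.
Proof. by move=> zA; rewrite -[d]push_idE zA push0l. Qed.

Lemma realized C A (d : ext C A) :
  exists B (x : Hom A B) (y : Hom B C), realizes d x y.
Proof. by have [] := et_class d. Qed.

Section OneTriangle.
Variables (A B C : K) (d : ext C A) (x : Hom A B) (y : Hom B C).
Hypothesis dxy : realizes d x y.

Let split_zero M N := @et_zero K M N.

Lemma triangle_comp0 : y \c x = 0.
Proof.
(* Compare with the triangle A -> A -> 0, in the form A -> A (+) 0 -> 0. *)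
have [|c [cE _]] := et_ET3 (split_zero A (zero_ob K)) dxy
  (a := idm A) (b := x \c prl_ _ _).
  by rewrite -comp_assoc prl_inl !comp_idr.
have := congr1 (fun h => h \c inl_ A (zero_ob K)) cE.
rewrite -!comp_assoc prl_inl comp_idr => <-.
by rewrite prr_inl comp0r.
Qed.

(** The next four lemmas are the exactness of the sequences
    Hom(W,A) -> Hom(W,B) -> Hom(W,C) -> E(W,A) and
    Hom(C,W) -> Hom(B,W) -> Hom(A,W) -> E(C,W). *)
Lemma factor_fst W (f : Hom W B) : y \c f = 0 -> exists g, f = x \c g.
Proof.
move=> yf0.
have [|a [aE _]] := et_ET3op (split_zero W (zero_ob K)) dxy
  (b := f \c prl_ _ _) (c := 0).
  by rewrite comp0l comp_assoc yf0 comp0l.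
by exists a; rewrite -aE -comp_assoc prl_inl comp_idr.
Qed.

Lemma factor_snd W (g : Hom B W) : g \c x = 0 -> exists h, g = h \c y.
Proof.
move=> gx0.
have [|c [cE _]] := et_ET3 dxy (split_zero (zero_ob K) W)
  (a := 0) (b := inr_ _ _ \c g).
  by rewrite comp0r -comp_assoc gx0 comp0r.
by exists c; rewrite cE comp_assoc prr_inr comp_idl.
Qed.

Lemma extend_along_fst W (f : Hom A W) :
  push f d = 0 <-> exists g, g \c x = f.
Proof.
split=> [fd0 | [g <-]].
  have [|b [bx _]] := et_lift dxy (split_zero W C) (a := f) (c := idm C).
    by rewrite /ext_morphism [LHS]fd0 raddf0.
  by exists (prl_ _ _ \c b); rewrite -comp_assoc bx comp_assoc prl_inl comp_idl.
have [|c [_ dE]] := et_ET3 dxy (split_zero W (zero_ob K))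
  (a := g \c x) (b := inl_ _ _ \c g); first by rewrite comp_assoc.
by rewrite [LHS]dE raddf0.
Qed.

Lemma lift_along_snd W (f : Hom W C) :
  pull f d = 0 <-> exists g, y \c g = f.
Proof.
split=> [fd0 | [g <-]].
  have [|b [_ yb]] := et_lift (split_zero A W) dxy (a := idm A) (c := f).
    by rewrite /ext_morphism [RHS]fd0 raddf0.
  by exists (b \c inr_ _ _); rewrite comp_assoc yb -comp_assoc prr_inr comp_idr.
have [|a [_ dE]] := et_ET3op (split_zero (zero_ob K) W) dxy
  (b := g \c prr_ _ _) (c := y \c g); first by rewrite comp_assoc.
by rewrite -[LHS]dE raddf0.
Qed.

Lemma section_split (s : Hom C B) : y \c s = idm C -> d = 0.
Proof. by move=> ys; rewrite -[d]pull_idE; apply/lift_along_snd; exists s. Qed.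

Lemma retraction_split (r : Hom B A) : r \c x = idm A -> d = 0.
Proof.
by move=> rx; rewrite -[d]push_idE; apply/extend_along_fst; exists r.
Qed.

End OneTriangle.

(** Five lemma, carried out with the two exact sequences above: a right
    inverse of [b] is built from the covariant one and a left inverse from the
    contravariant one. *)
Lemma middle_iso A B C A' B' C' (d : ext C A) (d' : ext C' A')
    (x : Hom A B) (y : Hom B C) (x' : Hom A' B') (y' : Hom B' C')
    (a : Hom A A') (b : Hom B B') (c : Hom C C') :
  realizes d x y -> realizes d' x' y' -> push a d = pull c d' ->
  b \c x = x' \c a -> y' \c b = c \c y -> iso a -> iso c -> iso b.
Proof.
move=> dxy dxy' ad bx yb [a' [a'a aa']] [c' [c'c cc']].
have [g0 yg0] : exists g0, y \c g0 = c' \c y'.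
  apply/(lift_along_snd dxy); rewrite -[LHS]push_idE -a'a push_compE.
  rewrite push_pullE ad -pull_compE comp_assoc cc' comp_idl.
  suff -> : pull y' d' = 0 by rewrite raddf0.
  by apply/(lift_along_snd dxy'); exists (idm B'); rewrite comp_idr.
have [g1 g1x] : exists g1, g1 \c x' = x \c a'.
  apply/(extend_along_fst dxy'); rewrite -[LHS]pull_idE -cc' pull_compE.
  rewrite -push_pullE -ad -push_compE -comp_assoc a'a comp_idr.
  suff -> : push x d = 0 by rewrite raddf0.
  by apply/(extend_along_fst dxy); exists (idm B); rewrite comp_idl.
have [h hE] : exists h, idm B' - b \c g0 = x' \c h.
  apply: (factor_fst dxy'); rewrite compBr comp_idr comp_assoc yb.
  by rewrite -comp_assoc yg0 comp_assoc cc' comp_idl subrr.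
have [k kE] : exists k, idm B - g1 \c b = k \c y.
  apply: (factor_snd dxy); rewrite compBl comp_idl -comp_assoc bx.
  by rewrite comp_assoc g1x -comp_assoc a'a comp_idr subrr.
apply: (@iso_of_inverses _ _ _ b (g1 + k \c c' \c y') (g0 + x \c a' \c h)).
  rewrite compDl -!comp_assoc yb (comp_assoc c') c'c comp_idl -kE.
  by rewrite addrCA subrr addr0.
rewrite compDr !comp_assoc bx -(comp_assoc x') aa' comp_idr -hE.
by rewrite addrCA subrr addr0.
Qed.

(** E-triangles may be transported along isomorphisms of their end terms: the
    transported extension has some realization, which [middle_iso] compares
    with the given sequence. *)
Lemma etriangle_iso A B C A' C' (x : Hom A B) (y : Hom B C)
    (a' : Hom A' A) (c : Hom C C') :
  etriangle x y -> iso a' -> iso c -> etriangle (x \c a') (c \c y).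
Proof.
move=> [d dxy] [a [aa' a'a]] isoc; have [c' [c'c cc']] := isoc.
set d' := push a (pull c' d).
have [B' [x' [y' dxy']]] := realized d'.
have dE : push a d = pull c d'.
  by rewrite /d' -push_pullE -pull_compE c'c pull_idE.
have [b [bx yb]] := et_lift dxy dxy' dE.
exists d'; apply/(proj2 (et_class d') _ _ _ dxy').
have [b' [b'b bb']] : iso b.
  by apply: middle_iso dxy dxy' dE bx yb _ isoc; exists a'.
exists b'; split; first by exists b.
  have -> : x' = b \c x \c a' by rewrite bx -comp_assoc aa' comp_idr.
  by rewrite -(comp_assoc b) comp_assoc b'b comp_idl.
by rewrite -yb -comp_assoc bb' comp_idr.
Qed.

Lemma third_zero A B C (x : Hom A B) (y : Hom B C) :
  etriangle x y -> is_zero A -> is_zero B -> is_zero C.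
Proof.
move=> [d dxy] zA zB.
have [s ys] : exists s, y \c s = idm C.
  by apply/(lift_along_snd dxy); rewrite (ext_to_zero d zA) raddf0.
by rewrite /is_zero -ys (to_zero s zB) comp0r.
Qed.

Lemma cone_of_iso_zero A B C (x : Hom A B) (y : Hom B C) :
  etriangle x y -> iso x -> is_zero C.
Proof.
move=> [d dxy] [x' [x'x xx']].
have y0 : y = 0.
  by rewrite -[y]comp_idr -xx' comp_assoc (triangle_comp0 dxy) comp0l.
have [s ys] : exists s, y \c s = idm C.
  by apply/(lift_along_snd dxy); rewrite (retraction_split dxy x'x) raddf0.
by rewrite /is_zero -ys y0 comp0l.
Qed.

Lemma iso_of_cone_zero A B C (x : Hom A B) (y : Hom B C) :
  etriangle x y -> is_zero C -> iso x.
Proof.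
move=> [d dxy] zC.
have [g xg] : exists g, idm B = x \c g.
  by apply: (factor_fst dxy); apply: to_zero zC.
have [r rx] : exists r, r \c x = idm A.
  by apply/(extend_along_fst dxy); rewrite (ext_from_zero d zC) raddf0.
exact: iso_of_inverses rx (esym xg).
Qed.

End Triangles.

(** * Syzygies up to projective summands *)

Section Syzygies.
Variable K : extriangulated_category.
Implicit Types A B C M N P S U V W : K.

Definition orthogonal M N : Prop := trivial_group (ext M N).

Lemma projective_orthogonal P N : projective P -> orthogonal P N.
Proof.
move=> projP d; have [B [x [y dxy]]] := realized d.
have defl_y : deflation y by exists N, x, d.
have [s ys] := projP _ _ y defl_y (idm P); exact: (section_split dxy ys).
Qed.

Lemma orthogonal_isor M N N' :
  isomorphic N N' -> orthogonal M N -> orthogonal M N'.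
Proof.
move=> [f [g [_ fg]]] MN d.
by rewrite -[d]push_idE -fg push_compE [push g d]MN raddf0.
Qed.

(** [S'] is a retract of [S] in the quotient of the category by the morphisms
    that factor through a projective.  Syzygies depend on choices, but only up
    to this relation. *)
Definition stable_retract S' S : Prop :=
  exists (a' : Hom S' S) (a : Hom S S') (P : K) (t : Hom S' P) (q : Hom P S'),
    projective P /\ idm S' - a \c a' = q \c t.

Lemma orthogonal_stable_retract S' S N :
  stable_retract S' S -> orthogonal S N -> orthogonal S' N.
Proof.
move=> [a' [a [P [t [q [projP E]]]]]] SN d.
have : pull (idm S' - a \c a') d = 0.
  by rewrite E pull_compE [pull q d](projective_orthogonal projP) raddf0.
by rewrite pullB pull_idE pull_compE [pull a d]SN raddf0 subr0.
Qed.

Lemma zero_projective : projective (zero_ob K).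
Proof.
move=> B C g _ f; exists 0.
by rewrite comp0r [f](from_zero _ (zero_obP K)).
Qed.

Lemma isomorphic_stable_retract S' S : isomorphic S' S -> stable_retract S' S.
Proof.
move=> [a' [a [aa' _]]]; exists a', a, (zero_ob K), 0, 0.
by split; [exact: zero_projective | rewrite aa' subrr comp0l].
Qed.

Lemma syzygy_lift M' M S' S P' P (d' : ext M' S') (d : ext M S)
    (x' : Hom S' P') (y' : Hom P' M') (x : Hom S P) (y : Hom P M)
    (c : Hom M' M) :
  projective P' -> realizes d' x' y' -> realizes d x y ->
  exists s : Hom S' S, push s d' = pull c d.
Proof.
move=> projP' dxy' dxy.
have defl_y : deflation y by exists S, x, d.
have [b yb] := projP' _ _ y defl_y (c \c y').
by have [s [_ sE]] := et_ET3op dxy' dxy (esym yb); exists s.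
Qed.

(** If [1 - c c'] factors as [q t] through a projective, lift [c'] and [c] to
    [s'] and [s] on syzygies.  Then [1 - s s'] pushes the extension of [S']
    forward to its pullback along [q t], which vanishes because [q] starts at a
    projective; hence [1 - s s'] factors through the middle term [P']. *)
Lemma syzygy_stable_retract M' M S' S :
  is_syzygy M' S' -> is_syzygy M S ->
  stable_retract M' M -> stable_retract S' S.
Proof.
move=> [P' [x' [y' [projP' [d' dxy']]]]] [P [x [y [projP [d dxy]]]]].
move=> [c' [c [Q [t [q [projQ cE]]]]]].
have [s' s'E] := syzygy_lift c' projP' dxy' dxy.
have [s sE] := syzygy_lift c projP dxy dxy'.
have [r rE] : exists r, r \c x' = idm S' - s \c s'.
  apply/(extend_along_fst dxy').
  have -> : push (idm S' - s \c s') d' = pull (idm M' - c \c c') d'.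
    rewrite pushB pullB push_idE pull_idE push_compE s'E push_pullE sE.
    by rewrite pull_compE.
  by rewrite cE pull_compE [pull q d'](projective_orthogonal projQ) raddf0.
by exists s', s, P', x', r.
Qed.

Lemma syzygy_chain_stable_retract (U V : nat -> K) :
  (forall k, is_syzygy (U k) (U k.+1)) ->
  (forall k, is_syzygy (V k) (V k.+1)) ->
  isomorphic (U 0%N) (V 0%N) -> forall k, stable_retract (U k) (V k).
Proof.
move=> sU sV UV; elim=> [|k IHk]; first exact: isomorphic_stable_retract.
exact: syzygy_stable_retract (sU k) (sV k) IHk.
Qed.

Lemma orthogonal_split M N B (x : Hom N B) (y : Hom B M) :
  etriangle x y -> orthogonal M N -> isomorphic B (biprod N M).
Proof.
move=> [d dxy] MN; move: dxy; rewrite (MN d) => sxy.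
have /(proj2 (et_class _) _ _ _ sxy) [b [isob _ _]] := et_zero N M.
by exists b.
Qed.

End Syzygies.

(** * Transfer along functors that preserve E-triangles *)

Definition preserves_etriangles (K L : extriangulated_category)
    (F : additive_functor K L) : Prop :=
  forall (A B C : K) (x : Hom A B) (y : Hom B C),
    etriangle x y -> etriangle (F <$> x) (F <$> y).

Lemma exact_preserves_etriangles (K L : extriangulated_category)
    (F : additive_functor K L) : exact F -> preserves_etriangles F.
Proof.
move=> [_ [eta [_ _ etaR]]] A B C x y [d dxy].
by exists (eta C A d); apply: etaR.
Qed.

Section AdjointVanishing.
Variables K L : extriangulated_category.
Variables (F : additive_functor K L) (G : additive_functor L K).
Variable adj : adjunction F G.

(** Apply [G] to a realization N -> M' -> F M of an extension: the unit of [M]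
    lifts to [G M'], and the transpose of this lift is a section. *)
Lemma orthogonal_left_adjoint M N :
  preserves_etriangles G -> orthogonal M (G N) -> orthogonal (F M) N.
Proof.
move=> presG MGN d; have [B [x [y dxy]]] := realized d.
have [|e exy] := presG _ _ _ x y; first by exists d.
have [h hE] : exists h, (G <$> y) \c h = adj_unit adj M.
  by apply/(lift_along_snd exy); apply: MGN.
apply: (section_split dxy (s := adj_counit adj B \c (F <$> h))).
rewrite comp_assoc -adj_counit_nat -comp_assoc -fmap_comp hE.
exact: adj_triangle_l.
Qed.

Lemma orthogonal_right_adjoint M N :
  preserves_etriangles F -> orthogonal (F M) N -> orthogonal M (G N).
Proof.
move=> presF FMN d; have [B [x [y dxy]]] := realized d.
have [|e exy] := presF _ _ _ x y; first by exists d.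
have [h hE] : exists h, h \c (F <$> x) = adj_counit adj N.
  by apply/(extend_along_fst exy); apply: FMN.
apply: (retraction_split dxy (r := (G <$> h) \c adj_unit adj B)).
rewrite -comp_assoc adj_unit_nat comp_assoc -fmap_comp hE.
exact: adj_triangle_r.
Qed.

Lemma left_adjoint_projective P :
  preserves_etriangles G -> projective P -> projective (F P).
Proof.
move=> presG projP B C g [A [x txg]] f.
have [|h hE] := projP _ _ (G <$> g) _ ((G <$> f) \c adj_unit adj P).
  by exists (G A), (G <$> x); apply: presG.
exists (adj_counit adj B \c (F <$> h)).
rewrite comp_assoc -adj_counit_nat -comp_assoc -fmap_comp hE fmap_comp.
by rewrite comp_assoc adj_counit_nat -comp_assoc adj_triangle_l comp_idr.
Qed.

End AdjointVanishing.

Section Perpendicular.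
Variable K : ET_category.
Implicit Types (X Y : K -> Prop) (k : nat).

Lemma Omega_syzygy (M : K) : is_syzygy M (Omega M).
Proof. exact: projT2 (cid (et_enough_projectives M)). Qed.

(** Vanishing of the extension groups of degree [k.+1]; degree one is the
    orthogonality in a cotorsion pair and the other degrees are heredity. *)
Definition perpendicular k X Y : Prop :=
  forall M N, X M -> Y N -> orthogonal (iter k (@Omega K) M) N.

Lemma perpendicular_sub k X X' Y Y' :
  subclass X X' -> subclass Y Y' ->
  perpendicular k X' Y' -> perpendicular k X Y.
Proof. by move=> XX' YY' perp M N /XX' XM /YY' YN; apply: perp. Qed.

Definition complete X Y : Prop :=
  forall C : K,
    (exists (B A : K) (x : Hom B A) (y : Hom A C),
       [/\ Y B, X A & etriangle x y])
    /\ (exists (B A : K) (x : Hom C B) (y : Hom B A),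
       [/\ Y B, X A & etriangle x y]).

(** Ordinary and hereditary cotorsion pairs are treated together: they are the
    cases where [D] holds only at [0] and where [D] holds everywhere. *)
Definition cotorsion_pair_in (D : nat -> Prop) X Y : Prop :=
  [/\ additive_subcategory X, additive_subcategory Y,
      forall k, D k -> perpendicular k X Y & complete X Y].

Lemma cotorsion_pairP X Y :
  cotorsion_pair X Y <-> cotorsion_pair_in (eq 0%N) X Y.
Proof.
split=> -[addX addY perp cXY]; split=> //; first by move=> _ <-.
exact: (perp 0%N).
Qed.

Lemma hereditary_cotorsion_pairP X Y :
  hereditary_cotorsion_pair X Y <-> cotorsion_pair_in (fun _ => True) X Y.
Proof.
split=> [[[addX addY perp0 cXY] her] | [addX addY perp cXY]].
  by split=> // -[|k] _ M N XM YN; [exact: perp0 | exact: (her k.+2)].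
split; first by split=> //; apply: (perp 0%N).
by case=> [|[|k]] // _ M N XM YN; apply: (perp k.+1).
Qed.

Lemma cotorsion_pair_summand X Y N :
  cotorsion_pair X Y -> summand_closed Y ->
  (forall M, X M -> orthogonal M N) -> Y N.
Proof.
move=> [_ _ _ cXY] sumY XN.
have [_ [B [A [x [y [YB XA txy]]]]]] := cXY N.
exact: sumY YB (orthogonal_split txy (XN A XA)).
Qed.

End Perpendicular.

Section Transfer.
Variables K L : ET_category.
Implicit Types k : nat.

Lemma complete_transfer (F : additive_functor K L)
    (X Y : K -> Prop) (X' Y' : L -> Prop) :
  preserves_etriangles F -> (forall N, exists M, isomorphic (F M) N) ->
  (forall M, X M -> X' (F M)) -> (forall M, Y M -> Y' (F M)) ->
  complete X Y -> complete X' Y'.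
Proof.
move=> presF denseF FX FY cXY N; have [M [c isoc]] := denseF N.
have [[B [A [x [y [YB XA txy]]]]] [B' [A' [x' [y' [YB' XA' txy']]]]]] := cXY M.
have iso_id (V : L) : iso (idm V) by exists (idm V); rewrite comp_idl.
split.
  exists (F B), (F A), ((F <$> x) \c idm _), (c \c (F <$> y)).
  by split; [exact: FY | exact: FX | apply: etriangle_iso => //; apply: presF].
have [c' [c'c cc']] := isoc.
exists (F B'), (F A'), ((F <$> x') \c c'), (idm _ \c (F <$> y')).
split; [exact: FY | exact: FX | apply: etriangle_iso => //; first exact: presF].
by exists c.
Qed.

Variables (F : additive_functor K L) (G : additive_functor L K).
Variable adj : adjunction F G.
Hypotheses (presF : preserves_etriangles F) (presG : preserves_etriangles G).

Lemma fmap_syzygy M S : is_syzygy M S -> is_syzygy (F M) (F S).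
Proof.
move=> [P [x [y [projP txy]]]]; exists (F P), (F <$> x), (F <$> y).
by split; [exact: left_adjoint_projective adj P presG projP | exact: presF].
Qed.

Lemma Omega_fmap k (M : K) (M' : L) : isomorphic (F M) M' ->
  stable_retract (iter k (@Omega L) M') (F (iter k (@Omega K) M))
  /\ stable_retract (F (iter k (@Omega K) M)) (iter k (@Omega L) M').
Proof.
move=> isoM.
have sL j : is_syzygy (iter j (@Omega L) M') (iter j.+1 (@Omega L) M').
  exact: Omega_syzygy.
have sK j : is_syzygy (F (iter j (@Omega K) M)) (F (iter j.+1 (@Omega K) M)).
  exact: fmap_syzygy (Omega_syzygy _).
split; first exact: (syzygy_chain_stable_retract sL sK (isomorphic_sym isoM)).
exact: (syzygy_chain_stable_retract sK sL isoM).
Qed.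

Lemma perpendicular_left_adjoint k (X Y : K -> Prop) (Y' : L -> Prop) :
  (forall N, Y' N -> Y (G N)) ->
  perpendicular k X Y -> perpendicular k (image_class F X) Y'.
Proof.
move=> GY perp M' N [M [XM isoM]] Y'N.
apply: orthogonal_stable_retract (proj1 (Omega_fmap k isoM)) _.
by apply: (orthogonal_left_adjoint adj presG); apply: perp (GY N Y'N).
Qed.

Lemma perpendicular_right_adjoint k (X : K -> Prop) (X' Y' : L -> Prop) :
  (forall M, X M -> X' (F M)) ->
  perpendicular k X' Y' -> perpendicular k X (image_class G Y').
Proof.
move=> FX perp M N' XM [N [Y'N isoN]]; apply: orthogonal_isor isoN _.
apply: (orthogonal_right_adjoint adj presF).
apply: orthogonal_stable_retract
  (proj2 (Omega_fmap k (isomorphic_refl (F M)))) _.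
exact: perp (FX M XM) Y'N.
Qed.

End Transfer.

(** * Recollements *)

Section Recollement.
Variables A B C : ET_category.
Variable r : recollement A B C.

Notation il := (il_star r).
Notation iu := (iu_star r).
Notation ish := (iu_shriek r).
Notation ju := (ju_star r).
Notation jl := (jl_star r).

Lemma il_preserves : preserves_etriangles il.
Proof. exact: exact_preserves_etriangles (il_star_exact r). Qed.

Lemma ju_preserves : preserves_etriangles ju.
Proof. exact: exact_preserves_etriangles (ju_star_exact r). Qed.

Lemma iu_il_iso M : isomorphic (iu (il M)) M.
Proof. by eexists; apply: (counit_iso (adj_iu_il r) (@il_star_ff _ _ _ r)). Qed.

Lemma iu_shriek_il_iso M : isomorphic (ish (il M)) M.
Proof.
apply: isomorphic_sym.
by eexists; apply: (unit_iso (adj_il_iu r) (@il_star_ff _ _ _ r)).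
Qed.

Lemma ju_jl_iso M : isomorphic (ju (jl M)) M.
Proof. by eexists; apply: (counit_iso (adj_ju_jl r) (@jl_star_ff _ _ _ r)). Qed.

Lemma ju_il_zero M : is_zero (ju (il M)).
Proof. by apply/im_il_ker_ju; exists M; apply: isomorphic_refl. Qed.

Lemma hom_il_jl_zero M N (f : Hom (il M) (jl N)) : f = 0.
Proof.
rewrite -[f]comp_idl -(adj_triangle_r (adj_ju_jl r)) -comp_assoc.
rewrite adj_unit_nat (to_zero (adj_unit _ (il M))) ?comp0r //.
by apply: fmap_zero; apply: ju_il_zero.
Qed.

Lemma iu_shriek_jl_zero N : is_zero (ish (jl N)).
Proof.
rewrite /is_zero -(adj_triangle_r (adj_il_iu r)).
by rewrite [adj_counit _ _]hom_il_jl_zero raddf0 comp0l.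
Qed.

Lemma zero_of_ju_iu_shriek (W : B) :
  is_zero (ju W) -> is_zero (ish W) -> is_zero W.
Proof.
move=> /im_il_ker_ju [M isoM] zW; apply: (is_zero_iso isoM).
apply: fmap_zero; apply: is_zero_iso zW.
apply: isomorphic_trans (iu_shriek_il_iso M).
exact: fmap_isomorphic (isomorphic_sym isoM).
Qed.

(** For an E-triangle with last map [g] the left exact functor j_* gives an
    E-triangle ending in some [T], and a compatible inflation [m] from [T] to
    the expected third term.  Its cone [W] is killed by i^!, which is exact and
    kills the image of j_*.  It is also killed by j^*: the morphism j^*(m) is
    compatible, an inflation, and by (WIC) a deflation, as j^* j_*(g) is
    isomorphic to [g]; hence it is invertible.  So [W] is zero and [m] is
    invertible. *)
Lemma jl_preserves : exact ish -> preserves_etriangles jl.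
Proof.
move=> /exact_preserves_etriangles ish_pres M N P f g [d dfg].
have [_ _ [T [m [eta [m_infl triT _]]]]] := jl_star_left_exact r.
have [[W [w tmw]] m_comp] := m_infl M P d.
have [y [gE txy]] := triT _ _ _ _ _ _ dfg.
have {}txy : etriangle (jl <$> f) y by exists (eta M P d).
have zT : is_zero (ish (T M P d)).
  by apply: third_zero (ish_pres _ _ _ _ _ txy) _ _; apply: iu_shriek_jl_zero.
have zW : is_zero (ish W).
  exact: third_zero (ish_pres _ _ _ _ _ tmw) zT (iu_shriek_jl_zero _).
have ju_m_defl : deflation (ju <$> m M P d).
  set eps := adj_counit (adj_ju_jl r).
  have iso_eps : forall V, iso (eps V) := counit_iso _ (@jl_star_ff _ _ _ r).
  have [e [eN Ne]] := iso_eps N; have [e' [eP Pe]] := iso_eps P.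
  have [V [z tz]] : deflation (eps P \c (ju <$> m M P d)).
    apply: (proj2 (et_WIC C)) ((ju <$> y) \c e) _ _.
    rewrite comp_assoc -(comp_assoc (eps P)) -fmap_comp -gE.
    rewrite adj_counit_nat -comp_assoc Ne comp_idr.
    by exists M, f, d.
  exists V, (z \c idm V).
  rewrite -[ju <$> _]comp_idl -eP -comp_assoc.
  apply: etriangle_iso tz _ _; first by exists (idm V); rewrite comp_idl.
  by exists (eps P).
have ju_m_iso : iso (ju <$> m M P d).
  apply: (proj1 (ju_star_exact r)) ju_m_defl => //.
  by exists (ju W), (ju <$> w); apply: ju_preserves.
have isom : iso (m M P d).
  apply: (iso_of_cone_zero tmw); apply: zero_of_ju_iu_shriek zW.
  exact: (cone_of_iso_zero (ju_preserves tmw) ju_m_iso).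
rewrite gE -[jl <$> f]comp_idr; apply: etriangle_iso txy _ isom.
by exists (idm _); rewrite comp_idl.
Qed.

Section Induced.
Hypothesis exact_ish : exact ish.
Variables (D : nat -> Prop) (X Y : B -> Prop).

Lemma ish_preserves : preserves_etriangles ish.
Proof. exact: exact_preserves_etriangles. Qed.

(** The approximations of [N] are the images of those of [j_* N], as
    [j^* j_* N] is isomorphic to [N]. *)
Lemma cotorsion_pair_ju :
  (forall N, image_class ju Y N -> Y (jl N)) ->
  cotorsion_pair_in D X Y ->
  cotorsion_pair_in D (image_class ju X) (image_class ju Y).
Proof.
move=> jlY [addX addY perp cXY]; split; try exact: image_class_additive.
  move=> k Dk.
  apply: (perpendicular_left_adjoint (adj_ju_jl r) _ _ jlY (perp k Dk));
    [exact: ju_preserves | exact: jl_preserves].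
apply: complete_transfer cXY; first exact: ju_preserves.
- by move=> N; exists (jl N); apply: ju_jl_iso.
- by move=> M; apply: image_class_in.
- by move=> M; apply: image_class_in.
Qed.

Lemma cotorsion_pair_of_ju :
  additive_subcategory X -> additive_subcategory Y ->
  (forall M, isomorphic (jl (ju M)) M) ->
  cotorsion_pair_in D (image_class ju X) (image_class ju Y) ->
  cotorsion_pair_in D X Y.
Proof.
move=> addX addY jl_ju [_ _ perp cXY]; split=> //.
  move=> k Dk.
  apply: (perpendicular_sub (fun M XM => XM)
    (subclass_image_class_comp (X := Y) jl_ju)).
  apply: (perpendicular_right_adjoint (adj_ju_jl r) _ _ _ (perp k Dk)).
  - exact: ju_preserves.
  - exact: jl_preserves.
  - by move=> M; apply: image_class_in.
apply: complete_transfer cXY; first exact: jl_preserves.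
- by move=> N; exists (ju N).
- apply: image_class_comp_sub; apply: image_class_sub => // M XM.
  exact: additive_subcategory_iso addX (isomorphic_sym (jl_ju M)) XM.
- apply: image_class_comp_sub; apply: image_class_sub => // M YM.
  exact: additive_subcategory_iso addY (isomorphic_sym (jl_ju M)) YM.
Qed.

Hypothesis exact_iu : exact iu.

Lemma iu_preserves : preserves_etriangles iu.
Proof. exact: exact_preserves_etriangles. Qed.

Lemma cotorsion_pair_iu :
  (forall N, image_class iu Y N -> Y (il N)) ->
  cotorsion_pair_in D X Y ->
  cotorsion_pair_in D (image_class iu X) (image_class iu Y).
Proof.
move=> ilY [addX addY perp cXY]; split; try exact: image_class_additive.
  move=> k Dk.
  apply: (perpendicular_left_adjoint (adj_iu_il r) _ _ ilY (perp k Dk));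
    [exact: iu_preserves | exact: il_preserves].
apply: complete_transfer cXY; first exact: iu_preserves.
- by move=> N; exists (il N); apply: iu_il_iso.
- by move=> M; apply: image_class_in.
- by move=> M; apply: image_class_in.
Qed.

(** If [N] is isomorphic to [i^* M] then it is also isomorphic to
    [i^! i_* N], and [i_* N] lies in the given class. *)
Lemma image_iu_sub_image_ish (V : B -> Prop) :
  (forall N, image_class iu V N -> V (il N)) ->
  subclass (image_class iu V) (image_class ish V).
Proof.
move=> ilV N VN; exists (il N); split; first exact: ilV.
exact: iu_shriek_il_iso.
Qed.

(** Approximations are transported by i^* in both variables, which is what puts
    i^*(X) on the left; on the right [image_iu_sub_image_ish] moves i^*(Y) into
    i^!(Y). *)
Lemma cotorsion_pair_iu_ish :
  (forall N, image_class iu X N -> X (il N)) ->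
  (forall N, image_class iu Y N -> Y (il N)) ->
  cotorsion_pair_in D X Y ->
  cotorsion_pair_in D (image_class iu X) (image_class ish Y).
Proof.
move=> ilX ilY [addX addY perp cXY]; split; try exact: image_class_additive.
  move=> k Dk.
  apply: (perpendicular_right_adjoint (adj_il_iu r) _ _ ilX (perp k Dk));
    [exact: il_preserves | exact: ish_preserves].
apply: complete_transfer cXY; first exact: iu_preserves.
- by move=> N; exists (il N); apply: iu_il_iso.
- by move=> M; apply: image_class_in.
- by move=> M YM; apply: image_iu_sub_image_ish => //; apply: image_class_in.
Qed.

Hypothesis il_iu : forall M : B, isomorphic (il (iu M)) M.

Lemma iu_closed (V : B -> Prop) : additive_subcategory V ->
  forall N, image_class iu V N -> V (il N).
Proof.
move=> addV; apply: image_class_comp_sub; apply: image_class_sub => // M VM.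
exact: additive_subcategory_iso addV (isomorphic_sym (il_iu M)) VM.
Qed.

Lemma ish_closed (V : B -> Prop) : additive_subcategory V ->
  forall N, image_class ish V N -> V (il N).
Proof.
(* Here i^! M is isomorphic to i^! i_* i^* M, hence to i^* M. *)
move=> addV N [M [VM isoM]].
apply: (additive_subcategory_iso addV _ VM).
apply: isomorphic_trans (isomorphic_sym (il_iu M)) _.
apply: fmap_isomorphic; apply: isomorphic_trans isoM.
apply: isomorphic_trans (isomorphic_sym (iu_shriek_il_iso (iu M))) _.
exact: fmap_isomorphic.
Qed.

Hypotheses (addX : additive_subcategory X) (addY : additive_subcategory Y).

Lemma cotorsion_pair_of_iu :
  cotorsion_pair_in D (image_class iu X) (image_class iu Y) ->
  cotorsion_pair_in D X Y.
Proof.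
move=> [_ _ perp cXY]; split=> //.
  move=> k Dk.
  apply: (perpendicular_sub (fun M XM => XM)
    (subclass_image_class_comp (X := Y) il_iu)).
  apply: (perpendicular_right_adjoint (adj_iu_il r) _ _ _ (perp k Dk)).
  - exact: iu_preserves.
  - exact: il_preserves.
  - by move=> M; apply: image_class_in.
apply: complete_transfer cXY; first exact: il_preserves.
- by move=> N; exists (iu N).
- exact: iu_closed.
- exact: iu_closed.
Qed.

Lemma cotorsion_pair_of_iu_ish :
  cotorsion_pair_in D (image_class iu X) (image_class ish Y) ->
  cotorsion_pair_in D X Y.
Proof.
move=> [_ _ perp cXY]; split=> //.
  move=> k Dk.
  apply: (perpendicular_sub (subclass_image_class_comp (X := X) il_iu)
    (fun N YN => YN)).
  apply: (perpendicular_left_adjoint (adj_il_iu r) _ _ _ (perp k Dk)).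
  - exact: il_preserves.
  - exact: ish_preserves.
  - by move=> M; apply: image_class_in.
apply: complete_transfer cXY; first exact: il_preserves.
- by move=> N; exists (iu N).
- exact: iu_closed.
- exact: ish_closed.
Qed.

End Induced.

(** One inclusion is [image_iu_sub_image_ish].  For the other, [i_* i^! M] is
    right orthogonal to X by two adjunctions, as [i_* i^*] preserves X and
    [M] is in Y; summand closure then puts [i_* i^! M] into Y. *)
Lemma image_iu_eq_image_ish (X Y : B -> Prop) : exact iu ->
  (forall N, image_class iu X N -> X (il N)) ->
  (forall N, image_class iu Y N -> Y (il N)) ->
  cotorsion_pair X Y -> summand_closed Y ->
  same_class (image_class iu Y) (image_class ish Y).
Proof.
move=> exact_iu ilX ilY cpXY sumY N; split; first exact: image_iu_sub_image_ish.
move=> [M [YM isoM]]; exists (il (ish M)); split; last first.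
  exact: isomorphic_trans (iu_il_iso _) isoM.
apply: (cotorsion_pair_summand cpXY sumY) => V XV.
apply: (orthogonal_right_adjoint (adj_iu_il r) (iu_preserves exact_iu)).
apply: (orthogonal_right_adjoint (adj_il_iu r) il_preserves).
case: cpXY => _ _ perp _; apply: perp YM.
by apply: ilX; apply: image_class_in.
Qed.

End Recollement.

(** * Cotorsion triples in a recollement *)

Theorem theorem4p10 (A B C : ET_category) (r : recollement A B C)
    (X Y Z : B -> Prop)
    (subX : additive_subcategory X)
    (subY : additive_subcategory Y)
    (subZ : additive_subcategory Z)
    (iX : subclass (image_class (il_star r \F iu_star r) X) X)
    (iY : subclass (image_class (il_star r \F iu_star r) Y) Y)
    (iZ : subclass (image_class (il_star r \F iu_star r) Z) Z)
    (jY : subclass (image_class (jl_star r \F ju_star r) Y) Y)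
    (jZ : subclass (image_class (jl_star r \F ju_star r) Z) Z)
    (exact_iu_star : exact (iu_star r))
    (exact_iu_shriek : exact (iu_shriek r)) :
  (cotorsion_triple X Y Z ->
     ((summand_closed Y ->
         same_class (image_class (iu_star r) Y) (image_class (iu_shriek r) Y))
      /\ cotorsion_triple (image_class (iu_star r) X)
           (image_class (iu_star r) Y) (image_class (iu_shriek r) Z))
     /\ cotorsion_triple (image_class (ju_star r) X)
          (image_class (ju_star r) Y) (image_class (ju_star r) Z)
     /\ (hereditary_cotorsion_triple X Y Z ->
           hereditary_cotorsion_triple (image_class (iu_star r) X)
             (image_class (iu_star r) Y) (image_class (iu_shriek r) Z)
           /\ hereditary_cotorsion_triple (image_class (ju_star r) X)
                (image_class (ju_star r) Y) (image_class (ju_star r) Z)))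
  /\
  (same_class (image_class (iu_star r) Y) (image_class (iu_shriek r) Y) ->
   cotorsion_triple (image_class (iu_star r) X)
     (image_class (iu_star r) Y) (image_class (iu_shriek r) Z) ->
   cotorsion_triple (image_class (ju_star r) X)
     (image_class (ju_star r) Y) (image_class (ju_star r) Z) ->
     (nat_isomorphic (il_star r \F iu_star r) (id_functor B)
      \/ (nat_isomorphic (jl_shriek r \F ju_star r) (id_functor B)
          /\ nat_isomorphic (jl_star r \F ju_star r) (id_functor B)) ->
      cotorsion_triple X Y Z)
     /\
     ((nat_isomorphic (il_star r \F iu_star r) (id_functor B)
       /\ hereditary_cotorsion_triple (image_class (iu_star r) X)
            (image_class (iu_star r) Y) (image_class (iu_shriek r) Z))
      \/ (nat_isomorphic (jl_shriek r \F ju_star r) (id_functor B)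
          /\ nat_isomorphic (jl_star r \F ju_star r) (id_functor B)
          /\ hereditary_cotorsion_triple (image_class (ju_star r) X)
               (image_class (ju_star r) Y) (image_class (ju_star r) Z)) ->
      hereditary_cotorsion_triple X Y Z)).
Proof.
have [ilX ilY ilZ] := And3 (image_class_comp_sub iX)
  (image_class_comp_sub iY) (image_class_comp_sub iZ).
have [jlY jlZ] := conj (image_class_comp_sub jY) (image_class_comp_sub jZ).
have iu_triple D : cotorsion_pair_in D X Y -> cotorsion_pair_in D Y Z ->
    cotorsion_pair_in D (image_class (iu_star r) X) (image_class (iu_star r) Y)
    /\ cotorsion_pair_in D (image_class (iu_star r) Y)
         (image_class (iu_shriek r) Z).
  by move=> cXY cYZ; split;
    [exact: cotorsion_pair_iu | exact: cotorsion_pair_iu_ish].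
have ju_triple D : cotorsion_pair_in D X Y -> cotorsion_pair_in D Y Z ->
    cotorsion_pair_in D (image_class (ju_star r) X) (image_class (ju_star r) Y)
    /\ cotorsion_pair_in D (image_class (ju_star r) Y)
         (image_class (ju_star r) Z).
  by move=> cXY cYZ; split; apply: cotorsion_pair_ju.
split.
  move=> [cpXY cpYZ]; split; [|split].
  - split; first exact: image_iu_eq_image_ish cpXY.
    have [] := iu_triple (eq 0%N); try exact/cotorsion_pairP.
    by split; apply/cotorsion_pairP.
  - have [] := ju_triple (eq 0%N); try exact/cotorsion_pairP.
    by split; apply/cotorsion_pairP.
  - move=> [/hereditary_cotorsion_pairP hXY /hereditary_cotorsion_pairP hYZ].
    have [iXY iYZ] := iu_triple _ hXY hYZ.
    have [jXY jYZ] := ju_triple _ hXY hYZ.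
    by do 2!split; apply/hereditary_cotorsion_pairP.
move=> _ tripleA tripleC.
have of_iu_triple D :
    nat_isomorphic (il_star r \F iu_star r) (id_functor B) ->
    cotorsion_pair_in D (image_class (iu_star r) X) (image_class (iu_star r) Y) ->
    cotorsion_pair_in D (image_class (iu_star r) Y)
      (image_class (iu_shriek r) Z) ->
    cotorsion_pair_in D X Y /\ cotorsion_pair_in D Y Z.
  move=> nat_il_iu cXY cYZ.
  have il_iu M := nat_isomorphic_id M nat_il_iu.
  by split;
    [exact: (cotorsion_pair_of_iu exact_iu_star il_iu)
    | exact: (cotorsion_pair_of_iu_ish exact_iu_shriek il_iu)].
have of_ju_triple D :
    nat_isomorphic (jl_star r \F ju_star r) (id_functor B) ->
    cotorsion_pair_in D (image_class (ju_star r) X) (image_class (ju_star r) Y) ->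
    cotorsion_pair_in D (image_class (ju_star r) Y) (image_class (ju_star r) Z) ->
    cotorsion_pair_in D X Y /\ cotorsion_pair_in D Y Z.
  move=> nat_jl_ju cXY cYZ.
  have jl_ju M := nat_isomorphic_id M nat_jl_ju.
  by split; apply: (cotorsion_pair_of_ju exact_iu_shriek _ _ jl_ju).
split.
  move=> [il_iu | [_ jl_ju]].
    have [/cotorsion_pairP cXY /cotorsion_pairP cYZ] := tripleA.
    by have [] := of_iu_triple _ il_iu cXY cYZ; split; apply/cotorsion_pairP.
  have [/cotorsion_pairP cXY /cotorsion_pairP cYZ] := tripleC.
  by have [] := of_ju_triple _ jl_ju cXY cYZ; split; apply/cotorsion_pairP.
move=> [[il_iu []] | [_ [jl_ju []]]] /hereditary_cotorsion_pairP hXY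
  /hereditary_cotorsion_pairP hYZ.
  have [] := of_iu_triple _ il_iu hXY hYZ.
  by split; apply/hereditary_cotorsion_pairP.
have [] := of_ju_triple _ jl_ju hXY hYZ.
by split; apply/hereditary_cotorsion_pairP.
Qed.
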